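(* Let $\mathcal V$ be a unital commutative associative algebra with an automorphism $S$ and a multiplicative $\lambda$-bracket $\{\cdot\,_\lambda\,\cdot\}$. Suppose that the pseudodifference operator $L(S)\in\mathcal V((S^{-1}))$ or $L(S)\in\mathcal V((S))$ satisfies the multiplicative Adler identity $$\{L(z)_\lambda L(w)\}=L(w\lambda S)\,\delta_+\Big(\frac{w\lambda S}{z}\Big)L^*\Big(\frac{\lambda}{z}\Big)-L(z)\,\delta_+\Big(\frac{w\lambda S}{z}\Big)L(w)-\frac12\big(L(w\lambda S)+L(w)\big)\Big(L^*\Big(\frac\lambda z\Big)-L(z)\Big).$$ Then the multiplicative skewsymmetry relation holds: $$\{L(z)_\lambda L(w)\}=-\sum_n S^{-n}(c_n)\lambda^{-n}\quad\text{where}\quad \{L(w)_\lambda L(z)\}=\sum_n c_n\lambda^n$$ ($c_n$ being bilateral series in $z,w$ with coefficients in $\mathcal V$), and the multiplicative Jacobi identity holds: $$\{L(z)_\lambda\{L(w)_\mu L(v)\}\}-\{L(w)_\mu\{L(z)_\lambda L(v)\}\}=\{\{L(z)_\lambda L(w)\}_{\lambda\mu}L(v)\}.$$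
   Context: The base field $\mathbb F$ has characteristic $0$. A multiplicative $\lambda$-bracket on $\mathcal V$ is a linear map $\mathcal V\otimes\mathcal V\to\mathcal V[\lambda,\lambda^{-1}]$, $a\otimes b\mapsto\{a_\lambda b\}$, satisfying: sesquilinearity $\{S(a)_\lambda b\}=\lambda^{-1}\{a_\lambda b\}$, $\{a_\lambda S(b)\}=\lambda S\{a_\lambda b\}$ ($S$ acting on coefficients); left Leibniz rule $\{a_\lambda bc\}=\{a_\lambda b\}c+\{a_\lambda c\}b$; right Leibniz rule $\{ab_\lambda c\}=\sum_n\big(p_nS^n(b)+q_nS^n(a)\big)\lambda^n$, where $\{a_\lambda c\}=\sum_np_n\lambda^n$ and $\{b_\lambda c\}=\sum_nq_n\lambda^n$. (No skewsymmetry or Jacobi identity is assumed.) $\mathcal V((S^{\pm1}))$ means $\mathcal V((S))$ or $\mathcal V((S^{-1}))$, Laurent series in $S$ resp. $S^{-1}$ with coefficients on the left and product determined by $S\circ f=S(f)S$, $f\in\mathcal V$. For $L(S)=\sum_nu_nS^n$, the symbol is $L(z)=\sum_nu_nz^n$, the formal adjoint is $L^*(S)=\sum_nS^{-n}\circ u_n$, and $\delta_+(x)=\sum_{k\ge0}x^k$. In the Adler identity: $L(w\lambda S)=\sum_nu_nw^n\lambda^nS^n$, $L^*(\lambda/z)=\sum_nS^{-n}(u_n)\lambda^{-n}z^n$, $\delta_+(w\lambda S/z)=\sum_{k\ge0}w^k\lambda^kz^{-k}S^k$, and each occurrence of $S$ acts on all coefficients written to its right; e.g. $L(w\lambda S)\delta_+(\frac{w\lambda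 S}z)L^*(\frac\lambda z)=\sum_{m,n}\sum_{k\ge0}u_mS^{m+k-n}(u_n)\,w^{m+k}\lambda^{m+k-n}z^{n-k}$ and $L(z)\delta_+(\frac{w\lambda S}z)L(w)=\sum_{m,n}\sum_{k\ge0}u_mS^k(u_n)z^{m-k}w^{n+k}\lambda^k$. Each coefficient of $z^iw^j$ is a finite sum. The left-hand side is $\{L(z)_\lambda L(w)\}=\sum_{i,j}\{{u_i}_\lambda u_j\}z^iw^j$; brackets are extended bilinearly over the formal variables. *)

(* Defs.v *)
From HB Require Import structures.
From mathcomp Require Import all_boot all_order all_algebra.
From mathcomp Require Import boolp classical_sets functions cardinality fsbigop.
Set Implicit Arguments.
Unset Strict Implicit.
Unset Printing Implicit Defensive.
Import GRing.Theory Num.Theory.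
Local Open Scope classical_set_scope.
Local Open Scope ring_scope.

Section MultiplicativeBrackets.
Context {F : fieldType} {V : comAlgType F}.

Record automorphism := Automorphism {
  aut :> {lrmorphism V -> V};
  aut_inv : V -> V;
  autK : cancel aut aut_inv;
  aut_invK : cancel aut_inv aut
}.

(* S^n for an integer n; Negz k stands for - k.+1. *)
Definition autpow (S : automorphism) (n : int) : V -> V :=
  match n with
  | Posz k => iter k S
  | Negz k => iter k.+1 (aut_inv S)
  end.

(* [br a b n] is the coefficient of lambda^n in {a_lambda b}; [br_fin] says
   that {a_lambda b} is a Laurent polynomial. *)
Record mult_bracket (S : automorphism) := MultBracket {
  br :> V -> V -> int -> V;
  br_fin : forall a b, finite_set [set n | br a b n != 0];
  br_linearl : forall (c : F) a a' b n,
    br (c *: a + a') b n = c *: br a b n + br a' b n;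
  br_linearr : forall (c : F) a b b' n,
    br a (c *: b + b') n = c *: br a b n + br a b' n;
  br_sesquil : forall a b n, br (S a) b n = br a b (n + 1);
  br_sesquir : forall a b n, br a (S b) n = S (br a b (n - 1));
  br_leibnizl : forall a b c n, br a (b * c) n = br a b n * c + br a c n * b;
  br_leibnizr : forall a b c n,
    br (a * b) c n =
      br a c n * autpow S n b + br b c n * autpow S n a
}.

(* The sequence u of the coefficients of L(S) = \sum_n u_n S^n belongs to
   V((S^-1)), respectively to V((S)). *)
Definition pseudodiff_inv (u : int -> V) : Prop :=
  exists N : int, forall n, N < n -> u n = 0.
Definition pseudodiff_pos (u : int -> V) : Prop :=
  exists N : int, forall n, n < N -> u n = 0.

(* Coefficients of L^*(S) = \sum_n S^(-n) o u_n = \sum_n S^(-n)(u_n) S^(-n). *)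
Definition adjoint (S : automorphism) (u : int -> V) : int -> V :=
  fun n => autpow S n (u (- n)).

(* delta_+(x) = \sum_(k >= 0) x^k *)
Definition delta_plus : int -> V := fun n => if 0 <= n then 1 else 0.

(* Formal series in z, w, lambda: [f i j l] is the coefficient of
   z^i w^j lambda^l. *)
Definition series3 := int -> int -> int -> V.

Definition one3 : series3 :=
  fun i j l => if [&& i == 0, j == 0 & l == 0] then 1 else 0.

(* For L = \sum_m u_m x^m, [L_at S u (a, b, c, e) f] is
   L(z^a w^b lambda^c S^e) f, with S acting on the coefficients of f.  The
   sum has at most one nonzero term in all the uses made of it in
   [adler_rhs]. *)
Definition L_at (S : automorphism) (u : int -> V)
    (x : int * int * int * int) (f : series3) : series3 :=
  let: (a, b, c, e) := x in fun i j l =>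
  \sum_(m \in [set: int])
    u m * autpow S (e * m) (f (i - a * m) (j - b * m) (l - c * m)).

Section Adler.
Variables (S : automorphism) (u : int -> V).

Let L_wlS := L_at S u (0, 1, 1, 1).                       (* L(w lambda S) *)
Let L_z := L_at S u (1, 0, 0, 0).
Let L_w := L_at S u (0, 1, 0, 0).
Let Lstar_lz := L_at S (adjoint S u) (-1, 0, 1, 0).       (* L^*(lambda/z) *)
Let delta_wlSz := L_at S delta_plus (-1, 1, 1, 1).        (* delta_+(w lambda S/z) *)

Definition adler_rhs : series3 := fun i j l =>
  let d : series3 := fun i j l => Lstar_lz one3 i j l - L_z one3 i j l in
  L_wlS (delta_wlSz (Lstar_lz one3)) i j l
  - L_z (delta_wlSz (L_w one3)) i j l
  - (2^-1 : F) *: (L_wlS d i j l + L_w d i j l).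

Variable B : mult_bracket S.

(* {L(z)_lambda L(w)} *)
Definition bracketL : series3 := fun i j l => B (u i) (u j) l.

Definition mult_adler : Prop := forall i j l, bracketL i j l = adler_rhs i j l.

Definition mult_skewsymmetry : Prop := forall i j l,
  bracketL i j l = - autpow S l (bracketL j i (- l)).

(* Formal series in z, w, v, lambda, mu: [f i j k p q] is the coefficient of
   z^i w^j v^k lambda^p mu^q. *)
Definition series5 := int -> int -> int -> int -> int -> V.

(* {L(z)_lambda {L(w)_mu L(v)}} *)
Definition jacobi_zwv : series5 := fun i j k p q => B (u i) (B (u j) (u k) q) p.

(* {L(w)_mu {L(z)_lambda L(v)}} *)
Definition jacobi_wzv : series5 := fun i j k p q => B (u j) (B (u i) (u k) p) q.

(* {{L(z)_lambda L(w)}_{lambda mu} L(v)}: the coefficient a_n of lambda^n in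
   the inner bracket contributes lambda^n (lambda mu)^q {a_n _(q) L(v)}, so
   lambda^p mu^q comes from n = p - q only. *)
Definition jacobi_zw_v : series5 := fun i j k p q =>
  B (B (u i) (u j) (p - q)) (u k) q.

Definition mult_jacobi : Prop := forall i j k p q,
  jacobi_zwv i j k p q - jacobi_wzv i j k p q = jacobi_zw_v i j k p q.

End Adler.
End MultiplicativeBrackets.

Arguments automorphism {F} V.

(* Main.v *)
(* Comparing coefficients of z^i w^j lambda^l and absorbing the half-sum term
   of the Adler identity into the two truncated sums symmetrises them: with sgn
   the sign function (sgn 0 = 0), {u_i lambda u_j} has lambda^l-coefficient
     (sgn(j-i-l) - sgn(l))/2 * u_(i+l) S^l(u_(j-l))
       + ([l = j] - [l = -i])/2 * u_j S^l(u_i).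
   Skewsymmetry can be read off from this formula.  Expanding the Jacobi
   identity by the Leibniz rules and sesquilinearity gives a combination of six
   kinds of cubic monomials.  The coefficients of four of them cancel by
   elementary identities between Kronecker deltas; the other two reduce to
     sgn x sgn y - sgn(x+y)(sgn x + sgn y) = [x = y = 0] - 1,
   whose defect [x = y = 0] appears only at indices where these two monomials
   coincide, and there the two contributions cancel. *)
From HB Require Import structures.
Require Import Defs.
From mathcomp Require Import all_boot all_order all_algebra.
From mathcomp Require Import classical_sets fsbigop.
From mathcomp Require Import zify ring.
Import Order.TTheory GRing.Theory Num.Theory.
Local Open Scope ring_scope.

(** * Integer powers of S as algebra morphisms, and brackets of shifted arguments *)

Section AutomorphismPowers.
Context {F : fieldType} {V : comAlgType F} (S : automorphism V).

HB.instance Definition _ := GRing.isLinear.Build F V V *:%R (aut_inv S)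
  (can2_linear (autK S) (aut_invK S)).
HB.instance Definition _ := GRing.isMonoidMorphism.Build V V (aut_inv S)
  (can2_monoid_morphism (autK S) (aut_invK S)).

Lemma autpow_linear (n : int) (c : F) (x y : V) :
  autpow S n (c *: x + y) = c *: autpow S n x + autpow S n y.
Proof.
case: n => n /=; first by elim: n => //= n ->; rewrite linearP.
by elim: n => [|n /= ->]; rewrite /= linearP.
Qed.

Lemma autpowM (n : int) (x y : V) :
  autpow S n (x * y) = autpow S n x * autpow S n y.
Proof.
case: n => n /=; first by elim: n => //= n ->; rewrite rmorphM.
by elim: n => [|n /= ->]; rewrite /= rmorphM.
Qed.

Lemma autpow1 (n : int) : autpow S n 1 = 1.
Proof.
case: n => n /=; first by elim: n => //= n ->; rewrite rmorph1.
by elim: n => [|n /= ->]; rewrite /= rmorph1.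
Qed.

HB.instance Definition _ (n : int) :=
  GRing.isLinear.Build F V V *:%R (autpow S n) (autpow_linear n).
HB.instance Definition _ (n : int) :=
  GRing.isMonoidMorphism.Build V V (autpow S n) (autpow1 n, autpowM n).

Lemma autpowZ (n : int) (c : F) (x : V) :
  autpow S n (c *: x) = c *: autpow S n x.
Proof. exact: linearZ. Qed.

Lemma autpowS (n : int) (x : V) : autpow S (n + 1) x = S (autpow S n x).
Proof.
case: n => [n|[|n]].
- by have ->: Posz n + 1 = Posz n.+1 by lia.
- by rewrite /= aut_invK.
- have ->: Negz n.+1 + 1 = Negz n by lia.
  by rewrite /= aut_invK.
Qed.

Lemma autpowB1 (n : int) (x : V) :
  autpow S (n - 1) x = aut_inv S (autpow S n x).
Proof. by rewrite -[in RHS](subrK 1 n) autpowS autK. Qed.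

Lemma autpowD (m n : int) (x : V) :
  autpow S (m + n) x = autpow S m (autpow S n x).
Proof.
elim: m => [|m IH|m IH]; first by rewrite add0r.
- by rewrite -addn1 PoszD addrAC !autpowS IH.
- have ->: - (m.+1)%:Z = - m%:Z - 1 by lia.
  by rewrite addrAC !autpowB1 IH.
Qed.

Variable B : mult_bracket S.

Lemma br_autpowr (a b : V) (q p : int) :
  B a (autpow S q b) p = autpow S q (B a b (p - q)).
Proof.
elim: q p => [|q IH|q IH] p; first by rewrite subr0.
- by rewrite -addn1 PoszD !autpowS br_sesquir IH; congr (S (autpow _ _ (B _ _ _))); lia.
- have ->: - (q.+1)%:Z = - q%:Z - 1 by lia.
  apply: (can_inj (autK S)); rewrite !autpowB1 aut_invK.
  (* Negative powers: sesquilinearity is applied to the preimage under S and read backwards. *)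
  have := br_sesquir B a (aut_inv S (autpow S (- q%:Z) b)) (p + 1).
  by rewrite addrK aut_invK IH => <-; congr (autpow _ _ (B _ _ _)); lia.
Qed.

Lemma br_autpowl (a b : V) (n q : int) :
  B (autpow S n a) b q = B a b (q + n).
Proof.
elim: n q => [|n IH|n IH] q; first by rewrite addr0.
- by rewrite -addn1 PoszD autpowS br_sesquil IH; congr (B _ _ _); lia.
- have ->: - (n.+1)%:Z = - n%:Z - 1 by lia.
  rewrite autpowB1.
  have := br_sesquil B (aut_inv S (autpow S (- n%:Z) a)) b (q - 1).
  by rewrite subrK aut_invK IH => <-; congr (B _ _ _); lia.
Qed.

Lemma br0l (b : V) (n : int) : B 0 b n = 0.
Proof.
by have := br_linearl B (-1) 0 0 b n; rewrite scaler0 addr0 scaleN1r addNr.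
Qed.

Lemma br0r (a : V) (n : int) : B a 0 n = 0.
Proof.
by have := br_linearr B (-1) a 0 0 n; rewrite scaler0 addr0 scaleN1r addNr.
Qed.

Lemma br_lincombl (c d : F) (a a' b : V) (n : int) :
  B (c *: a + d *: a') b n = c *: B a b n + d *: B a' b n.
Proof.
by rewrite br_linearl -[d *: a']addr0 br_linearl br0l addr0.
Qed.

Lemma br_lincombr (c d : F) (a b b' : V) (n : int) :
  B a (c *: b + d *: b') n = c *: B a b n + d *: B a b' n.
Proof.
by rewrite br_linearr -[d *: b']addr0 br_linearr br0r addr0.
Qed.

End AutomorphismPowers.

(** * Scalar identities between signs and Kronecker deltas *)

Section CoefficientIdentities.
Context {F : fieldType}.

(** The scalars of u_(i+l) S^l(u_(j-l)) and of u_j S^l(u_i) in the bracket; the second arises from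
    the half-sum term alone. *)
Definition sgn_coef (i j l : int) : F := 2^-1 * (sgz (j - i - l) - sgz l)%:~R.
Definition edge_coef (i j l : int) : F :=
  2^-1 * ((l == j)%:R - (l == - i)%R%:R).

Lemma sgn_coef_skew (i j l : int) : sgn_coef j i (- l) = - sgn_coef i j l.
Proof.
rewrite /sgn_coef (_ : i - j - - l = - (j - i - l)); last lia.
by rewrite !sgzN -opprD rmorphN mulrN.
Qed.

Lemma edge_coef_skew (i j l : int) : edge_coef j i (- l) = - edge_coef i j l.
Proof.
rewrite /edge_coef (_ : (- l == i) = (l == - i)); last lia.
rewrite (_ : (- l == - j) = (l == j)); last lia.
by rewrite -mulrN opprB.
Qed.

Lemma sgz_addition (x y : int) :
  sgz x * sgz y - sgz (x + y) * (sgz x + sgz y) =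
    ((x == 0) && (y == 0))%:R - 1.
Proof.
by case: (sgzP x) => hx; case: (sgzP y) => hy; case: (sgzP (x + y)) => hxy; lia.
Qed.

(** The deltas agree after shifting indices. The right-hand side involves only coefficients shared
    by the three iterated brackets, so that they can cancel. *)
Lemma edge_coef_cocycle1 (i j k p q : int) :
  edge_coef i (j + q) p + edge_coef i (k - q) (p - q) =
    edge_coef i k p + edge_coef i j (p - q).
Proof.
rewrite /edge_coef.
rewrite (_ : (p == j + q) = (p - q == j)); last lia.
rewrite (_ : (p - q == k - q) = (p == k)); last lia.
ring.
Qed.

Lemma edge_coef_cocycle2 (i j k p q : int) :
  edge_coef (i + (p - q)) k q + edge_coef (j - (p - q)) k p =
    edge_coef j k q + edge_coef i k p.
Proof.
rewrite /edge_coef.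
rewrite (_ : (q == - (i + (p - q))) = (p == - i)); last lia.
rewrite (_ : (p == - (j - (p - q))) = (q == - j)); last lia.
ring.
Qed.

Hypothesis two_neq0 : (2 : F) != 0.

(** The coefficient of [mono1 i j k p q] in the Jacobi identity. Products mixing signs of p, q, p-q
    with the other signs cancel; what remains is [sgz_addition] at (k-j-q, j-i+q-p) minus its
    instance at (p, -q), and the constants -1 cancel. *)
Lemma sgn_coef_jacobi (i j k p q : int) :
  sgn_coef j k q * sgn_coef i (j + q) p
  - sgn_coef i k p * sgn_coef j (k - p) (q - p)
  - sgn_coef i j (p - q) * sgn_coef (i + (p - q)) k q =
    2^-1 ^+ 2 * (((k == j + q) && (k == i + p))%:R - ((p == 0) && (q == 0))%:R).
Proof.
have := sgz_addition (k - j - q) (j - i + q - p).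
have := sgz_addition p (- q).
rewrite (_ : k - j - q + (j - i + q - p) = k - i - p); last lia.
rewrite (_ : (k - j - q == 0) && (j - i + q - p == 0) =
             (k == j + q) && (k == i + p)); last lia.
rewrite oppr_eq0 sgzN => e1 e2.
have -> : (((k == j + q) && (k == i + p))%:R - ((p == 0) && (q == 0))%:R : F)
   = (((k == j + q) && (k == i + p))%:R - 1
      - (((p == 0) && (q == 0))%:R - 1))%:~R.
  by rewrite !(rmorphB, rmorph_nat) /=; ring.
rewrite -{}e1 -{}e2 /sgn_coef.
rewrite (_ : j + q - i - p = j - i + q - p); last lia.
rewrite (_ : k - p - j - (q - p) = k - j - q); last lia.
rewrite (_ : j - i - (p - q) = j - i + q - p); last lia.
rewrite (_ : k - (i + (p - q)) - q = k - i - p); last lia.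
rewrite (_ : q - p = - (p - q)) ?sgzN; last lia.
move: (sgz (k - j - q)) (sgz (j - i + q - p)) (sgz (k - i - p)) => a b c.
move: (sgz p) (sgz q) (sgz (p - q)) => x y z.
by rewrite !(rmorphB, rmorphD, rmorphM, rmorphN) /=; field.
Qed.
End CoefficientIdentities.

(** * Extraction of coefficients from the Adler identity *)

Section AdlerCoefficients.
Context {F : fieldType} {V : comAlgType F} (S : automorphism V).
Implicit Types (f : int -> V) (g : @series3 F V).

Lemma L_at_single (m0 a b c e : int) f g (i j l : int) :
  (forall m, m != m0 -> g (i - a * m) (j - b * m) (l - c * m) = 0) ->
  L_at S f (a, b, c, e) g i j l =
    f m0 * autpow S (e * m0) (g (i - a * m0) (j - b * m0) (l - c * m0)).
Proof.
move=> g0.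
rewrite /L_at -(fsbig_widen [set m0]%classic) ?fsbig_set1 //.
by move=> m /= [_ /eqP /g0 ->]; rewrite raddf0 mulr0.
Qed.

Lemma L_at_z_one (f : int -> V) (i j l : int) :
  L_at S f (1, 0, 0, 0) (@one3 F V) i j l =
    if (j == 0) && (l == 0) then f i else 0.
Proof.
rewrite (L_at_single i); last first.
  by move=> m; rewrite /one3; case: ifP => // /and3P[/eqP]; lia.
rewrite /one3 !mul0r mul1r !subr0 subrr eqxx /=.
by case: ifP; rewrite ?rmorph1 ?raddf0 ?mulr1 ?mulr0.
Qed.

Lemma L_at_w_one (f : int -> V) (i j l : int) :
  L_at S f (0, 1, 0, 0) (@one3 F V) i j l =
    if (i == 0) && (l == 0) then f j else 0.
Proof.
rewrite (L_at_single j); last first.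
  by move=> m; rewrite /one3; case: ifP => // /and3P[_ /eqP]; lia.
rewrite /one3 !mul0r mul1r !subr0 subrr eqxx /=.
by case: ifP; rewrite ?rmorph1 ?raddf0 ?mulr1 ?mulr0.
Qed.

Lemma L_at_lz_one (f : int -> V) (i j l : int) :
  L_at S f (-1, 0, 1, 0) (@one3 F V) i j l =
    if (j == 0) && (i == - l) then f l else 0.
Proof.
rewrite (L_at_single l); last first.
  by move=> m; rewrite /one3; case: ifP => // /and3P[_ _ /eqP]; lia.
rewrite /one3 !mul0r !mul1r !subr0 subrr eqxx mulN1r opprK addr_eq0 andbT andbC.
by case: ifP; rewrite ?rmorph1 ?raddf0 ?mulr1 ?mulr0.
Qed.

Variable u : int -> V.
Let Lz := L_at S u (1, 0, 0, 0) (@one3 F V).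
Let Lw := L_at S u (0, 1, 0, 0) (@one3 F V).
Let Lstar := L_at S (adjoint S u) (-1, 0, 1, 0) (@one3 F V).

Lemma delta_lstarE (i j l : int) :
  L_at S (@delta_plus F V) (-1, 1, 1, 1) Lstar i j l =
    if (0 <= j) && (i == - l) then autpow S l (u (i + j)) else 0.
Proof.
rewrite (L_at_single j); last first.
  move=> m mj; rewrite /Lstar L_at_lz_one; case: ifP => // /andP[/eqP]; lia.
rewrite /Lstar L_at_lz_one /delta_plus /adjoint !mul1r subrr eqxx /=.
rewrite mulN1r !opprK opprB.
have -> : (i + j == j - l) = (i == - l) by lia.
case: eqP => [->|_]; last by rewrite andbF raddf0 mulr0.
rewrite andbT; case: ifP => _; last by rewrite mul0r.
by rewrite mul1r -autpowD; congr (autpow _ _ (u _)); lia.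
Qed.

Lemma delta_lwE (i j l : int) :
  L_at S (@delta_plus F V) (-1, 1, 1, 1) Lw i j l =
    if (0 <= l) && (i == - l) then autpow S l (u (j - l)) else 0.
Proof.
rewrite (L_at_single l); last first.
  move=> m mj; rewrite /Lw L_at_w_one; case: ifP => // /andP[_ /eqP]; lia.
rewrite /Lw L_at_w_one /delta_plus !mul1r subrr eqxx andbT mulN1r opprK.
rewrite addr_eq0; case: eqP => _; last by rewrite andbF raddf0 mulr0.
by rewrite andbT; case: ifP => _; rewrite ?mul0r ?mul1r.
Qed.

Hypothesis two_neq0 : (2 : F) != 0.

Lemma adler_rhsE (i j l : int) :
  adler_rhs S u i j l =
    sgn_coef i j l *: (u (i + l) * autpow S l (u (j - l)))
    + edge_coef i j l *: (u j * autpow S l (u i)).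
Proof.
rewrite /adler_rhs -/Lz -/Lw -/Lstar.
(* The degrees force m = i+l and the exponent j-i-l in delta_+, whence the truncation l <= j-i; in
   the next product that exponent is l. *)
have -> : L_at S u (0, 1, 1, 1) (L_at S (@delta_plus F V) (-1, 1, 1, 1) Lstar)
    i j l = (l <= j - i)%R%:R *: (u (i + l) * autpow S l (u (j - l))).
  rewrite (L_at_single (i + l)) => [|m]; rewrite delta_lstarE; last first.
    by case: ifP => // /andP[_ /eqP]; lia.
  rewrite !mul1r !mul0r subr0.
  have -> : i == - (l - (i + l)) by lia.
  have -> : (0 <= j - (i + l)) = (l <= j - i) by lia.
  case: (l <= j - i)%R; rewrite /= ?mulr0n ?scale0r ?raddf0 ?mulr0 //.
  by rewrite mulr1n scale1r -autpowD; congr (_ * autpow _ _ (u _)); lia.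
have -> : L_at S u (1, 0, 0, 0) (L_at S (@delta_plus F V) (-1, 1, 1, 1) Lw)
    i j l = (0 <= l)%R%:R *: (u (i + l) * autpow S l (u (j - l))).
  rewrite (L_at_single (i + l)) => [|m]; rewrite delta_lwE; last first.
    by case: ifP => // /andP[_ /eqP]; lia.
  rewrite !mul1r !mul0r !subr0.
  have -> : i - (i + l) == - l by lia.
  by case: (0 <= l)%R; rewrite /= ?mulr0n ?mulr1n ?scale0r ?scale1r ?raddf0 ?mulr0.
have lstar x y t :
    Lstar x y t = ((y == 0) && (x == - t))%R%:R *: autpow S t (u x).
  rewrite /Lstar L_at_lz_one /adjoint; case: eqP => //= _; rewrite ?mulr0n ?scale0r //.
  by case: eqP => [->|_]; rewrite ?mulr0n ?mulr1n ?scale0r ?scale1r.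
have lz x y t : Lz x y t = ((y == 0) && (t == 0))%R%:R *: u x.
  by rewrite /Lz L_at_z_one; case: (_ && _); rewrite ?mulr0n ?mulr1n ?scale0r ?scale1r.
have d0 x y t : y != 0 -> Lstar x y t - Lz x y t = 0.
  by move=> /negPf y0; rewrite lstar lz y0 !mulr0n !scale0r subrr.
rewrite !(L_at_single j) => [|m|m]; do ?[by move=> mj; apply: d0; lia].
rewrite !mul1r !mul0r !subr0 subrr lstar lz eqxx /= lstar lz eqxx /=.
rewrite !rmorphB /= !autpowZ -autpowD.
rewrite (_ : (i == - (l - j)) = (l == j - i)); last lia.
rewrite subr_eq0 (_ : j + (l - j) = l); last lia.
have -> : (l == j)%:R *: autpow S j (u i) = (l == j)%:R *: autpow S l (u i).
  by case: eqP => [->|_] //; rewrite mulr0n !scale0r.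
have -> : (l == 0)%:R *: u i = (l == 0)%:R *: autpow S l (u i).
  by case: eqP => [->|_] //; rewrite mulr0n !scale0r.
rewrite -!scalerBl -!scalerAr.
set M := u (i + l) * _; set N := u j * autpow S l (u i).
(* at [l = j - i] and at [l = 0] the two monomials coincide *)
have MN : ((l == j - i)%:R - (l == 0)%:R) *: N =
    ((l == j - i)%:R - (l == 0)%:R) *: M :> V.
  rewrite !scalerBl; congr (_ - _); case: eqP => [l_eq|_]; rewrite ?mulr0n ?scale0r //.
    by congr (_ *: (u _ * autpow S l (u _))); lia.
  by rewrite /M /N l_eq addr0 subr0 /= mulrC.
(* The deltas at the two truncation boundaries move from N to M. *)
have -> : ((l == j - i)%:R - (l == j)%:R) *: N
    + ((i == - l)%:R - (l == 0)%:R) *: N =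
    ((l == j - i)%:R - (l == 0)%:R) *: M
    + ((i == - l)%:R - (l == j)%:R) *: N.
  by rewrite -MN -!scalerDl; congr (_ *: _); ring.
rewrite scalerDr !scalerA opprD addrA -!scalerBl -scaleNr.
congr (_ *: _ + _ *: _); last first.
  rewrite /edge_coef -mulrN opprB; congr (_ * (_ - _%:R)); lia.
rewrite /sgn_coef.
(* This is sgn x = 2 [x >= 0] - 1 - [x = 0] at x = j-i-l and at x = l, subtracted. *)
have -> : sgz (j - i - l) - sgz l =
    2 * ((l <= j - i)%R%:R - (0 <= l)%R%:R) - ((l == j - i)%:R - (l == 0)%:R).
  by case: (sgzP (j - i - l)); case: (sgzP l);
    case: (l =P j - i); case: (lerP l (j - i)); lia.
by rewrite !(rmorphB, rmorphM, rmorph_nat) /=; field.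
Qed.
End AdlerCoefficients.

(** * Skewsymmetry and the Jacobi identity *)

Section AdlerBracket.
Context {F : fieldType} {V : comAlgType F} (S : automorphism V).
Variables (u : int -> V) (B : mult_bracket S).

(** Turns scalars into elements of V, so that [ring] applies. *)
Lemma scale_in_alg (a : F) (x : V) : a *: x = in_alg V a * x.
Proof. by rewrite /= mulr_algl. Qed.

Hypothesis two_neq0 : (2 : F) != 0.
Hypothesis hadler : mult_adler u B.

Lemma adler_bracketE (i j l : int) :
  B (u i) (u j) l =
    sgn_coef i j l *: (u (i + l) * autpow S l (u (j - l)))
    + edge_coef i j l *: (u j * autpow S l (u i)).
Proof. by rewrite -adler_rhsE // -hadler. Qed.

(** Both scalars change sign under (i, j, l) -> (j, i, -l), while S^l only swaps the two factors of
    each monomial. *)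
Lemma adler_skewsymmetry : mult_skewsymmetry u B.
Proof.
move=> i j l; rewrite /bracketL !adler_bracketE.
rewrite sgn_coef_skew edge_coef_skew !scaleNr -opprD rmorphN rmorphD /= opprK.
rewrite !autpowZ !autpowM -!autpowD subrr /= opprK.
by congr (_ *: _ + _ *: _); rewrite mulrC.
Qed.

(* These cubic monomials, together with their images under exchanging (i, p)
   with (j, q), are all those occurring in the iterated brackets; mono3 and
   mono4 are symmetric under the exchange. *)
Let mono1 (i j k p q : int) :=
  u (i + p) * autpow S p (u (j + q - p)) * autpow S q (u (k - q)).
Let mono2 (i j k p q : int) :=
  u (j + q) * autpow S q (u (k - q)) * autpow S p (u i).
Let mono3 (i j k p q : int) :=
  u k * autpow S p (u (j + q - p)) * autpow S q (u (i + p - q)).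
Let mono4 (i j k p q : int) := u k * autpow S p (u i) * autpow S q (u j).

Lemma adler_nested_right (i j k p q : int) :
  B (u i) (B (u j) (u k) q) p =
    (sgn_coef j k q * sgn_coef i (j + q) p) *: mono1 i j k p q
    + (sgn_coef j k q * sgn_coef i (k - q) (p - q)) *: mono1 j i k q p
    + (sgn_coef j k q * (edge_coef i k p + edge_coef i j (p - q)))
      *: mono2 i j k p q
    + (edge_coef j k q * sgn_coef i k p) *: mono2 j i k q p
    + (edge_coef j k q * sgn_coef i j (p - q)) *: mono3 i j k p q
    + (edge_coef j k q * (edge_coef i k p + edge_coef i j (p - q)))
      *: mono4 i j k p q.
Proof.
(* Both factors of u_(j+q) S^q(u_(k-q)) contribute to [mono2], producing the left side of the
   cocycle identity. *)
rewrite -[in X in _ + X *: mono2 i j k p q](edge_coef_cocycle1 i j k p q).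
rewrite adler_bracketE br_lincombr !br_leibnizl !br_autpowr !adler_bracketE.
rewrite !rmorphD /= !autpowZ !autpowM -!autpowD.
rewrite (_ : q + (p - q) = p); last lia.
rewrite (_ : k - q - (p - q) = k - p); last lia.
rewrite (_ : i + (p - q) = i + p - q); last lia.
rewrite (_ : j - (p - q) = j + q - p); last lia.
rewrite /mono1 /mono2 /mono3 /mono4 !scale_in_alg.
ring.
Qed.

Lemma adler_nested_left (i j k p q : int) :
  B (B (u i) (u j) (p - q)) (u k) q =
    (sgn_coef i j (p - q) * sgn_coef (i + (p - q)) k q) *: mono1 i j k p q
    + (sgn_coef i j (p - q) * sgn_coef (j - (p - q)) k p) *: mono1 j i k q p
    + (edge_coef i j (p - q) * sgn_coef j k q) *: mono2 i j k p q
    + (edge_coef i j (p - q) * sgn_coef i k p) *: mono2 j i k q p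
    + (sgn_coef i j (p - q) * (edge_coef j k q + edge_coef i k p))
      *: mono3 i j k p q
    + (edge_coef i j (p - q) * (edge_coef j k q + edge_coef i k p))
      *: mono4 i j k p q.
Proof.
(* Here [mono3] is the monomial receiving edge terms from both factors. *)
rewrite -[in X in _ + X *: mono3 i j k p q](edge_coef_cocycle2 i j k p q).
rewrite adler_bracketE br_lincombl !br_leibnizr !br_autpowl.
rewrite (_ : q + (p - q) = p) ?adler_bracketE; last lia.
rewrite -!autpowD (_ : q + (p - q) = p); last lia.
rewrite (_ : i + (p - q) + q = i + p); last lia.
rewrite (_ : j - (p - q) + p = j + q); last lia.
rewrite (_ : j - (p - q) = j + q - p); last lia.
rewrite (_ : i + (p - q) = i + p - q); last lia.
rewrite /mono1 /mono2 /mono3 /mono4 !scale_in_alg.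
ring.
Qed.

(** If k = j+q = i+p, both monomials are u_k S^p(u_i) S^q(u_j); if p = q = 0, both are u_i u_j
    u_k. *)
Lemma mono1_residual (i j k p q : int) :
  (((k == j + q) && (k == i + p))%:R - ((p == 0) && (q == 0))%:R : F)
    *: (mono1 i j k p q - mono1 j i k q p) = 0.
Proof.
rewrite scalerBl /mono1.
case: andP => [[/eqP kj /eqP ki]|_]; case: andP => [[/eqP-> /eqP->]|_].
- by rewrite subrr.
- rewrite mulr0n scale0r subr0 -ki -kj.
  rewrite (_ : k - p = i) 1?(_ : k - q = j); try lia.
  by rewrite mulrAC subrr scaler0.
- by rewrite mulr0n scale0r sub0r !addr0 ?subr0 /= (mulrC (u j)) subrr scaler0 oppr0.
- by rewrite mulr0n !scale0r subrr.
Qed.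

Lemma adler_jacobi : mult_jacobi u B.
Proof.
move=> i j k p q.
rewrite /jacobi_zwv /jacobi_wzv /jacobi_zw_v.
rewrite !adler_nested_right adler_nested_left.
have res := mono1_residual i j k p q.
have J1 := sgn_coef_jacobi two_neq0 i j k p q.
(* The exchanged instance gives minus the coefficient of [mono1 j i k q p], with the same delta
   defect as [J1]. *)
have J2 := sgn_coef_jacobi two_neq0 j i k q p.
have sgnC : sgn_coef j i (q - p) = - sgn_coef i j (p - q) :> F.
  by rewrite -opprB sgn_coef_skew.
have edgeC : edge_coef j i (q - p) = - edge_coef i j (p - q) :> F.
  by rewrite -opprB edge_coef_skew.
have mono3C : mono3 j i k q p = mono3 i j k p q by rewrite /mono3 mulrAC.
have mono4C : mono4 j i k q p = mono4 i j k p q by rewrite /mono4 mulrAC.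
rewrite (_ : j + (q - p) = j - (p - q)) in J2; last lia.
rewrite andbC [(q == 0) && _]andbC in J2.
rewrite {}sgnC {}edgeC {}mono3C {}mono4C in J2 *.
apply/eqP; rewrite -subr_eq0; apply/eqP.
(* Zero is rewritten as a quarter of the residual, whose scalars [J1] and [J2] then expand; the goal
   becomes a polynomial identity. *)
rewrite -[RHS](scaler0 _ (2^-1 ^+ 2)) -{}res scalerA.
rewrite scalerBr -[in X in _ = X *: _ - _]J1 -[in X in _ = _ - X *: _]J2.
rewrite !scale_in_alg.
ring.
Qed.
End AdlerBracket.

Theorem proposition6p2 (F : fieldType) (charF0 : [pchar F] =i pred0)
    (V : comAlgType F) (S : automorphism V) (B : mult_bracket S)
    (u : int -> V) (hu : pseudodiff_inv u \/ pseudodiff_pos u)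
    (hadler : mult_adler u B) :
  mult_skewsymmetry u B /\ mult_jacobi u B.
Proof.
have two_neq0 : (2 : F) != 0.
  by apply/negP => two0; have := charF0 2%N; rewrite !inE two0.
by split; [apply: adler_skewsymmetry | apply: adler_jacobi].
Qed.
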